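(* Let $\mathcal H_A,\mathcal H_B$ be finite-dimensional complex Hilbert spaces and let $\Lambda$ be a nondegenerate spectrum of $\dim\mathcal H_A$ pairwise distinct real numbers. Then the local quantum uncertainty $\mathcal U_A^\Lambda$ is an entanglement monotone for pure states: whenever a pure state $|\psi\rangle\in\mathcal H_A\otimes\mathcal H_B$ is transformed by local operations and classical communication (LOCC) into an ensemble $\{p_i,|\phi_i\rangle\}$ of pure states in $\mathcal H_A\otimes\mathcal H_B$, one has $$\sum_i p_i\,\mathcal U_A^\Lambda(|\phi_i\rangle\langle\phi_i|)\le\mathcal U_A^\Lambda(|\psi\rangle\langle\psi|).$$
   Context: For a density matrix $\rho$ and a Hermitian operator $K$, the Wigner-Yanase skew information is $\mathcal I(\rho,K)=-\tfrac12\mathrm{Tr}\{[\rho^{1/2},K]^2\}$. The local quantum uncertainty is $\mathcal U_A^\Lambda(\rho)=\min_{K_A}\mathcal I(\rho,K_A\otimes\mathbb I_B)$, the minimum being over all Hermitian operators $K_A$ on $\mathcal H_A$ with spectrum $\Lambda$, i.e. $K_A=V\,\mathrm{diag}(\Lambda)\,V^\dagger$ with $V$ unitary. An LOCC transformation of pure states is a finite sequence of rounds; in each round one party applies, conditionally on all previous outcomes, a local operation given by Kraus operators, either $\{M_i\otimes\mathbb I_B\}$ with $M_i$ operators on $\mathcal H_A$ and $\sum_iM_i^\dagger M_i=\mathbb I_A$, or $\{\mathbb I_A\otimes N_i\}$ with $N_i$ operators on $\mathcal H_B$ and $\sum_iN_i^\dagger N_i=\mathbb I_B$. Outcome $i$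 of a round with (global) Kraus operators $\{M_i\}$ on $|\psi\rangle$ gives $|\phi_i\rangle$ with probability $p_i$, where $\sqrt{p_i}\,|\phi_i\rangle=M_i|\psi\rangle$ (outcomes with $p_i=0$ are discarded). *)

(* Defs.v *)
From HB Require Import structures.
From mathcomp Require Import all_boot all_order all_algebra.
From mathcomp Require Import complex mxtens.
From mathcomp Require Import all_classical all_reals all_analysis.

Set Implicit Arguments.
Unset Strict Implicit.
Unset Printing Implicit Defensive.

Import Order.TTheory GRing.Theory Num.Theory.
Import numFieldNormedType.Exports.

Local Open Scope ring_scope.
Local Open Scope complex_scope.
Local Open Scope sesquilinear_scope.
Local Open Scope classical_set_scope.

(* The Hilbert spaces of dimensions dA and dB are C^dA and C^dB with C = R[i],
   R a realType.  Their tensor product is C^(dA * dB), with the coordinates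
   identified by the Kronecker product *t of mxtens. *)

(* The square root given by the spectral decomposition; meaningful for
   positive semidefinite A. *)
Definition sqrtmx (C : numClosedFieldType) n (A : 'M[C]_n) : 'M[C]_n :=
  invmx (spectralmx A) *m diag_mx (map_mx sqrtC (spectral_diag A))
    *m spectralmx A.

Lemma sqrtmx_sqr (C : numClosedFieldType) n (A : 'M[C]_n) :
  A \is normalmx -> sqrtmx A *m sqrtmx A = A.
Proof.
move=> /orthomx_spectralP AE; rewrite [in RHS]AE /sqrtmx.
rewrite !mulmxA (mulmxK (spectral_unit A)) -[X in X *m _ = _]mulmxA.
rewrite mulmx_diag; congr (_ *m diag_mx _ *m _).
by apply/rowP => j; rewrite !mxE -expr2 sqrtCK.
Qed.

Section LocalQuantumUncertainty.
Variable R : realType.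
Local Notation C := R[i].

(* For Hermitian rho and K the trace is real, so that taking its real part
   only casts it from C to R. *)
Definition skew_information n (rho K : 'M[C]_n) : R :=
  let X := sqrtmx rho *m K - K *m sqrtmx rho in
  - 2^-1 * complex.Re (\tr (X *m X)).

Definition observables n (Lambda : 'I_n -> R) : set 'M[C]_n :=
  [set K | exists2 V : 'M[C]_n, V \is unitarymx &
             K = V *m diag_mx (\row_j (Lambda j)%:C) *m V^t*].

(* This infimum is a minimum, see lqu_min below. *)
Definition lqu dA dB (Lambda : 'I_dA -> R) (rho : 'M[C]_(dA * dB)) : R :=
  inf [set skew_information rho (K *t (1%:M : 'M[C]_dB)) |
        K in observables Lambda].

Section Attained.

Let cc (T : topologicalType) (g : T -> C) :=
  continuous (fun t => complex.Re (g t)) /\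
  continuous (fun t => complex.Im (g t)).

Let cmx (T : topologicalType) m n (A : T -> 'M[C]_(m, n)) :=
  forall i j, cc (fun t => A t i j).

Let cc_cst (T : topologicalType) c : cc (fun _ : T => c).
Proof. by split=> t; exact: cvg_cst. Qed.

Let ccD (T : topologicalType) (f g : T -> C) :
  cc f -> cc g -> cc (fun t => f t + g t).
Proof.
move=> [f1 f2] [g1 g2]; split => t.
  under eq_fun do rewrite raddfD /=.
  by apply: cvgD; [exact: f1|exact: g1].
under eq_fun do rewrite raddfD /=.
by apply: cvgD; [exact: f2|exact: g2].
Qed.

Let continuous_scale (T : topologicalType) (a : R) (f : T -> R) :
  continuous f -> continuous (fun t => a * f t).
Proof. by move=> cf t; apply: cvgM; [exact: cvg_cst|exact: cf]. Qed.

Let ccM (T : topologicalType) (f g : T -> C) :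
  cc f -> cc g -> cc (fun t => f t * g t).
Proof.
move=> [f1 f2] [g1 g2].
have ReM (x y : C) : complex.Re (x * y) =
    complex.Re x * complex.Re y - complex.Im x * complex.Im y.
  by case: x y => [a b] [c d].
have ImM (x y : C) : complex.Im (x * y) =
    complex.Re x * complex.Im y + complex.Im x * complex.Re y.
  by case: x y => [a b] [c d].
split => t.
  under eq_fun do rewrite ReM.
  apply: cvgB; apply: cvgM;
  [exact: f1|exact: g1|exact: f2|exact: g2].
under eq_fun do rewrite ImM.
apply: cvgD; apply: cvgM;
[exact: f1|exact: g2|exact: f2|exact: g1].
Qed.

Let ccJ (T : topologicalType) (f : T -> C) : cc f -> cc (fun t => (f t)^*%R).
Proof.
have ReJ (x : C) : complex.Re (Num.conj x) = complex.Re x by case: x.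
have ImJ (x : C) : complex.Im (Num.conj x) = - complex.Im x by case: x.
move=> [f1 f2]; split => t.
  by under eq_fun do rewrite ReJ; exact: f1.
by under eq_fun do rewrite ImJ; apply: cvgN; exact: f2.
Qed.

Let cc_sum (T : topologicalType) (I : Type) (s : seq I) (f : I -> T -> C) :
  (forall i, cc (f i)) -> cc (fun t => \sum_(i <- s) f i t).
Proof.
move=> cf; elim: s => [|i s IH].
  under eq_fun do rewrite big_nil; exact: cc_cst.
under eq_fun do rewrite big_cons; exact: ccD.
Qed.

Let cmxM (T : topologicalType) m n p (A : T -> 'M[C]_(m, n))
    (B : T -> 'M[C]_(n, p)) : cmx A -> cmx B -> cmx (fun t => A t *m B t).
Proof.
move=> cA cB i j; under eq_fun do rewrite mxE.
by apply: cc_sum => k; exact: ccM.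
Qed.

Let cmxJ (T : topologicalType) m n (A : T -> 'M[C]_(m, n)) :
  cmx A -> cmx (fun t => (A t)^t*).
Proof. by move=> cA i j; under eq_fun do rewrite !mxE; exact: ccJ. Qed.

Let cmx_cst (T : topologicalType) m n (A : 'M[C]_(m, n)) :
  cmx (fun _ : T => A).
Proof. by move=> i j; exact: cc_cst. Qed.

Variables (dA dB : nat) (Lambda : 'I_dA -> R) (rho : 'M[C]_(dA * dB)).

Let T : topologicalType :=
  prod_topology (fun _ : ('I_dA * 'I_dA * bool)%type => (R : topologicalType)).

Let V (f : T) : 'M[C]_dA :=
  \matrix_(i, j) (f (i, j, true) +i* f (i, j, false)).

Let cmxV : cmx V.
Proof.
by move=> i j; split => t; under eq_fun do rewrite mxE /=;
  exact: (@proj_continuous _ (fun _ => (R : topologicalType))).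
Qed.

Let K (U : 'M[C]_dA) := U *m diag_mx (\row_j (Lambda j)%:C) *m U^t*.

Let I (f : T) := skew_information rho (K (V f) *t (1%:M : 'M[C]_dB)).

Let continuous_I : continuous I.
Proof.
have cK : cmx (fun f : T => K (V f) *t (1%:M : 'M[C]_dB)).
  move=> i j; under eq_fun do rewrite mxE.
  apply: ccM; last exact: cc_cst.
  by apply: cmxM; [apply: cmxM => //; exact: cmx_cst|exact: cmxJ].
pose X f := sqrtmx rho *m (K (V f) *t (1%:M : 'M[C]_dB))
            - (K (V f) *t 1%:M) *m sqrtmx rho.
have cX : cmx X.
  move=> i j; rewrite /X; under eq_fun do rewrite mxE [X in _ + X]mxE -mulN1r.
  apply: ccD; first exact: cmxM.
  by apply: ccM; [exact: cc_cst|exact: cmxM].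
have [ctr _] : cc (fun f => \tr (X f *m X f)).
  by apply: cc_sum => i; exact: cmxM.
exact: (@continuous_scale T _ _ ctr).
Qed.

Let compact_unitary : compact [set f : T | V f \is unitarymx].
Proof.
have unitary_coef (U : 'M[C]_dA) i j :
    U \is unitarymx -> `|U i j| ^+ 2 <= (1 : C).
  move=> /unitarymxP/matrixP/(_ i i); rewrite !mxE eqxx mulr1n => <-.
  under eq_bigr do rewrite !mxE -normCK.
  by rewrite (bigD1 j)//= lerDl sumr_ge0// => k _; exact: exprn_ge0.
have bnd : [set f : T | V f \is unitarymx] `<=`
    [set f : T | forall x, `[(-1 : R), 1]%classic (f x)].
  move=> f /= Vf [[i j] b]; have Vij := unitary_coef _ i j Vf.
  have {Vij} : f (i, j, true) ^+ 2 + f (i, j, false) ^+ 2 <= 1.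
    move: Vij; rewrite mxE normc_def -rmorphXn/= sqr_sqrtr ?addr_ge0 ?sqr_ge0//.
    by rewrite (_ : 1 = 1%:C)// lecR.
  move=> Vij; rewrite in_itv/= -ler_norml -(@expr_le1 _ 2)// ?real_normK ?num_real//.
  by case: b; apply: le_trans Vij; rewrite ?lerDl ?lerDr sqr_ge0.
apply: subclosed_compact bnd; last first.
  apply: (@tychonoff _ (fun _ => (R : topologicalType)) (fun _ => `[-1, 1]%classic)).
  by move=> _; exact: segment_compact.
pose G (f : T) := V f *m (V f)^t*.
have cG : cmx G by apply: cmxM => //; exact: cmxJ.
have -> : [set f : T | V f \is unitarymx] =
    \bigcap_(ij : 'I_dA * 'I_dA)
      ([set f | complex.Re (G f ij.1 ij.2) = complex.Re ((1%:M : 'M[C]_dA) ij.1 ij.2)]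
       `&` [set f | complex.Im (G f ij.1 ij.2) = complex.Im ((1%:M : 'M[C]_dA) ij.1 ij.2)]).
  apply/seteqP; split => f /=.
    by move=> /unitarymxP Vf [i j] _ /=; rewrite /G Vf.
  move=> Gf; apply/unitarymxP/matrixP => i j; have [] := Gf (i, j) Logic.I.
  by rewrite /= /G; case: (_ i j) => a b; case: (_ i j) => c d /= -> ->.
apply: closed_bigI => -[i j] _ /=; have [c1 c2] := cG i j.
by apply: closedI; apply: (preimage_closed _ (@closed_eq _ _)) => t _;
  [exact: c1|exact: c2].
Qed.

Lemma lqu_min : exists2 K0 : 'M[C]_dA, observables Lambda K0 &
  lqu Lambda rho = skew_information rho (K0 *t (1%:M : 'M[C]_dB)) /\
  (forall K1, observables Lambda K1 ->
     lqu Lambda rho <= skew_information rho (K1 *t (1%:M : 'M[C]_dB))).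
Proof.
pose lift (U : 'M[C]_dA) : T := fun x : 'I_dA * 'I_dA * bool =>
  if x.2 then complex.Re (U x.1.1 x.1.2) else complex.Im (U x.1.1 x.1.2).
have VK U : V (lift U) = U.
  by apply/matrixP => i j; rewrite mxE /lift /=; case: (U i j).
have [||c] := @compact_EVT_min _ _ I _ _ compact_unitary.
- exists (lift 1%:M); rewrite /= VK; apply/unitarymxP.
  by rewrite trmx1 map_mx1 mulmx1.
- exact: continuous_subspaceT.
move=> /set_mem Vc cmin.
have oKc : observables Lambda (K (V c)) by exact: (ex_intro2 _ _ (V c) Vc erefl).
exists (K (V c)) => //.
have lb : lbound [set skew_information rho (K *t (1%:M : 'M[C]_dB)) |
    K in observables Lambda] (I c).
  move=> _ [_ [U uU ->] <-]; have := cmin (lift U).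
  by rewrite inE /I /= VK => /(_ uU).
have E : lqu Lambda rho = I c.
  apply/eqP; rewrite eq_le; apply/andP; split.
    by apply: ge_inf; [exists (I c)|exists (K (V c)) => //; exists (V c)].
  by apply: lb_le_inf => //; exists (I c); exists (K (V c)) => //; exists (V c).
split; first exact: E.
by move=> K1 oK1; rewrite E; apply: lb; exact: imageP.
Qed.

End Attained.

Definition density_of n (psi : 'cV[C]_n) : 'M[C]_n := psi *m psi^t*.

(* p = ||M psi||^2 *)
Definition outcome_prob n (M : 'M[C]_n) (psi : 'cV[C]_n) : R :=
  complex.Re (((M *m psi)^t* *m (M *m psi)) 0 0).

Definition outcome_state n (M : 'M[C]_n) (psi : 'cV[C]_n) : 'cV[C]_n :=
  (Num.sqrt (outcome_prob M psi))^-1%:C *: (M *m psi).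

Definition kraus n k (M : 'I_k -> 'M[C]_n) : Prop :=
  \sum_i (M i)^t* *m M i = 1%:M.

(* A protocol is a finite tree: the continuation after a round, in particular
   the acting party and its Kraus operators, depends on all outcomes so far. *)
Inductive locc (dA dB : nat) : Type :=
| Stop
| RoundA k (M : 'I_k -> 'M[C]_dA) of kraus M & 'I_k -> locc dA dB
| RoundB k (N : 'I_k -> 'M[C]_dB) of kraus N & 'I_k -> locc dA dB.

(* One round with the global Kraus operators G, outcome i being processed
   further by next i; outcomes of probability 0 are discarded. *)
Definition round_ensemble n k (G : 'I_k -> 'M[C]_n)
    (next : 'I_k -> 'cV[C]_n -> seq (R * 'cV[C]_n)) (psi : 'cV[C]_n) :
    seq (R * 'cV[C]_n) :=
  flatten [seq [seq (outcome_prob (G i) psi * o.1, o.2) |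
                 o <- next i (outcome_state (G i) psi)] |
            i <- enum 'I_k & outcome_prob (G i) psi != 0].

Fixpoint ensemble dA dB (P : locc dA dB) (psi : 'cV[C]_(dA * dB)) :
    seq (R * 'cV[C]_(dA * dB)) :=
  match P with
  | Stop => [:: (1, psi)]
  | RoundA _ M _ next =>
      round_ensemble (fun i => M i *t (1%:M : 'M[C]_dB))
        (fun i => ensemble (next i)) psi
  | RoundB _ N _ next =>
      round_ensemble (fun i => (1%:M : 'M[C]_dA) *t N i)
        (fun i => ensemble (next i)) psi
  end.

End LocalQuantumUncertainty.

(* Main.v *)
Require Import Defs.
From mathcomp Require Import all_boot all_fingroup all_order all_algebra.
From mathcomp Require Import complex mxtens ring lra.
From mathcomp Require Import all_classical all_reals all_analysis.

(* Since the variance is the least second moment, the uncertainty of a pure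
   state with reduced state sigma is the minimum, over unitaries V and reals c,
   of sum_j (Lambda_j - c)^2 (V^* sigma V)_jj.  This is a minimum of linear
   functions of sigma, hence concave and homogeneous, and it is invariant under
   unitary conjugation of sigma.  A round of B writes sigma as the sum of the
   unnormalised reduced states of the outcomes.  A round of A replaces
   sigma = S S^* by X_i X_i^* with X_i = M_i S; this is unitarily similar to
   X_i^* X_i, and these sum to S^* S, which is unitarily similar to sigma. *)

Set Implicit Arguments.
Unset Strict Implicit.
Unset Printing Implicit Defensive.

Import Order.TTheory GRing.Theory Num.Theory.

Local Open Scope ring_scope.
Local Open Scope sesquilinear_scope.

(** * Unitary similarity of normal matrices and of the two Gram matrices of a square matrix *)

Section UnitarySimilarity.

(** The block matrix [M] is made triangular in two ways: column operations expose the characteristic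
    matrix of [A *m B], row operations that of [B *m A]. Comparing determinants gives equality up to
    the factor ['X^n], which cancels. No inverse of [A] or [B] is taken, so singular matrices are
    covered. *)
Lemma char_poly_mulmxC (F : idomainType) n (A B : 'M[F]_n) :
  char_poly (A *m B) = char_poly (B *m A).
Proof.
pose a := map_mx polyC A; pose b := map_mx polyC B.
pose M := block_mx 'X%:M a b 1%:M.
have E1 : M *m block_mx 1%:M 0 (- b) 1%:M =
    block_mx (char_poly_mx (A *m B)) a 0 1%:M.
  rewrite mulmx_block !mulmx1 !mulmx0 !mulmxN mul1mx add0r add0r subrr.
  by rewrite /char_poly_mx map_mxM.
have E2 : block_mx 1%:M 0 (- b) 'X%:M *m M =
    block_mx 'X%:M a 0 (char_poly_mx (B *m A)).
  rewrite mulmx_block !mul1mx !mul0mx !addr0 !mulNmx mulmx1.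
  by rewrite scalar_mxC addNr addrC /char_poly_mx map_mxM.
have := congr1 determinant E2; have := congr1 determinant E1.
rewrite !det_mulmx !det_ublock !det_lblock !det1 !mul1r !mulr1 => ->.
move/mulfI; apply.
by rewrite det_scalar expf_neq0 // polyX_eq0.
Qed.

Variable C : numClosedFieldType.

Lemma unitarymx_trC_mul n (U : 'M[C]_n) :
  U \is unitarymx -> U^t* *m U = 1%:M.
Proof. by rewrite -trmxC_unitary => /unitarymxP; rewrite trmxCK. Qed.

Lemma perm_mx_unitary n (s : 'S_n) : (perm_mx s : 'M[C]_n) \is unitarymx.
Proof.
apply/unitarymxP.
by rewrite tr_perm_mx map_perm_mx -perm_mxM mulgV perm_mx1.
Qed.

Lemma trmxC_mul m n p (A : 'M[C]_(m, n)) (B : 'M[C]_(n, p)) :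
  (A *m B)^t* = B^t* *m A^t*.
Proof. by rewrite trmx_mul map_mxM. Qed.

Lemma normalmx_mul_trC m n (X : 'M[C]_(m, n)) : X *m X^t* \is normalmx.
Proof. by apply/normalmxP; rewrite trmxC_mul trmxCK. Qed.

Lemma spectral_decomposition n (A : 'M[C]_n) : A \is normalmx ->
  A = (spectralmx A)^t* *m diag_mx (spectral_diag A) *m spectralmx A.
Proof.
by move/orthomx_spectralP; rewrite invmx_unitary ?spectral_unitarymx.
Qed.

(** Both matrices are unitarily diagonalisable, and by unique factorisation of the characteristic
    polynomial their eigenvalue lists differ by a permutation. *)
Lemma unitary_similar_char_poly n (A B : 'M[C]_n) :
  A \is normalmx -> B \is normalmx -> char_poly A = char_poly B ->
  exists2 W, W \is unitarymx & A = W *m B *m W^t*.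
Proof.
move=> /spectral_decomposition AE /spectral_decomposition BE.
set d := spectral_diag A in AE; set e := spectral_diag B in BE.
set P := spectralmx A in AE; set Q := spectralmx B in BE.
have Pu : P \is unitarymx := spectral_unitarymx _.
have Qu : Q \is unitarymx := spectral_unitarymx _.
clearbody P Q d e.
have diagP n' (U : 'M[C]_n') f : U \is unitarymx ->
    char_poly (U^t* *m diag_mx f *m U) = \prod_(i < n') ('X - (f 0 i)%:P).
  move=> /unitarymxP Uu; rewrite char_poly_mulmxC mulmxA Uu mul1mx.
  rewrite char_poly_trig ?diag_mx_is_trig //.
  by apply: eq_bigr => i _; rewrite mxE eqxx.
rewrite {}AE {}BE !diagP // => deq.
pose D := [tuple d 0 i | i < n]; pose E := [tuple e 0 i | i < n].
have /tuple_permP[s sE] : perm_eq D E.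
  by apply: prod_XsubC_eq; rewrite !big_map /= -!big_enum in deq *.
have {}sE i : d 0 i = e 0 (s i).
  by move/val_inj/(congr1 (fun t => tnth t i)): sE; rewrite !tnth_mktuple.
(* Pass to the eigenbasis of [B], reorder the eigenvalues, and return from the eigenbasis of [A]. *)
exists (P^t* *m perm_mx s *m Q).
  by rewrite !mul_unitarymx ?trmxC_unitary ?perm_mx_unitary.
have dE : diag_mx d = perm_mx s *m diag_mx e *m (perm_mx s)^t*.
  rewrite tr_perm_mx map_perm_mx -row_permE -col_permE.
  apply/matrixP => i j; rewrite !mxE sE.
  by rewrite (inj_eq perm_inj).
rewrite dE !trmxC_mul trmxCK !mulmxA.
by rewrite (mulmxtVK _ Qu) (mulmxtVK _ Qu).
Qed.

Lemma mul_trC_unitary_similar n (X : 'M[C]_n) :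
  exists2 W, W \is unitarymx & X *m X^t* = W *m (X^t* *m X) *m W^t*.
Proof.
apply: unitary_similar_char_poly; first exact: normalmx_mul_trC.
  by have := normalmx_mul_trC (X^t*); rewrite trmxCK.
exact: char_poly_mulmxC.
Qed.

(** [A] will be a coefficient matrix, rectangular when the two dimensions differ; a square factor
    makes [mul_trC_unitary_similar] applicable. It is the diagonalising unitary times the root of
    the spectrum. *)
Lemma square_factor m n (A : 'M[C]_(m, n)) :
  exists S : 'M[C]_m, A *m A^t* = S *m S^t*.
Proof.
have := spectral_decomposition (normalmx_mul_trC A).
set U := spectralmx _; set d := spectral_diag _ => AE.
have Uu : U \is unitarymx := spectral_unitarymx _.
have d_ge0 i : 0 <= d 0 i.
  (* Each eigenvalue is the squared norm of a row of [U *m A]. *)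
  have -> : d 0 i = ((U *m A) *m (U *m A)^t*) i i.
    rewrite trmxC_mul mulmxA -[U *m A *m _]mulmxA AE !mulmxA.
    by rewrite (unitarymxP Uu) mul1mx mulmxtVK // !mxE eqxx.
  by rewrite mxE sumr_ge0 // => k _; rewrite !mxE -normCK exprn_ge0.
exists (U^t* *m diag_mx (map_mx sqrtC d)).
rewrite AE trmxC_mul trmxCK !mulmxA; congr (_ *m _).
rewrite -!mulmxA; congr (_ *m _).
rewrite tr_diag_mx map_diag_mx mulmx_diag; congr diag_mx.
apply/rowP => i; rewrite !mxE.
rewrite -[LHS]sqrtCK expr2; congr (_ * _); symmetry.
by apply: geC0_conj; rewrite sqrtC_ge0.
Qed.

End UnitarySimilarity.

(** * Reduced states and second moments of local observables *)

Section PureStates.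
Local Open Scope complex_scope.
Variable R : realType.
Local Notation C := R[i].

Lemma Re_scale (c : R) (z : C) : complex.Re (c%:C * z) = c * complex.Re z.
Proof. by case: z => a b /=; rewrite mul0r subr0. Qed.

Section CoefficientMatrix.
Variables dA dB : nat.
Implicit Types psi phi : 'cV[C]_(dA * dB).

(** Reading the vector as a matrix turns [A *t B] into left multiplication by [A] and right
    multiplication by the transpose of [B]; see [coefmx_tens]. *)
Definition coefmx psi : 'M[C]_(dA, dB) :=
  \matrix_(i, j) psi (mxtens_index (i, j)) 0.

(** This is the partial trace over B of [density_of psi]. *)
Definition reduced psi : 'M[C]_dA := coefmx psi *m (coefmx psi)^t*.

Lemma sum_mxtens (F : 'I_(dA * dB) -> C) :
  \sum_k F k = \sum_i \sum_j F (mxtens_index (i, j)).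
Proof.
rewrite pair_bigA /= (reindex (@mxtens_index dA dB)) /=.
  by apply: eq_bigr => -[].
exists (@mxtens_unindex dA dB) => k _.
  exact: mxtens_indexK.
exact: mxtens_unindexK.
Qed.

Lemma coefmx_tens (A : 'M[C]_dA) (B : 'M[C]_dB) psi :
  coefmx ((A *t B) *m psi) = A *m coefmx psi *m B^T.
Proof.
apply/matrixP => i j; rewrite -mulmxA !mxE sum_mxtens.
apply: eq_bigr => k _; rewrite mxE mulr_sumr; apply: eq_bigr => l _.
by rewrite tensmxE !mxE mulrAC -mulrA.
Qed.

Lemma inner_coefmx phi psi :
  (phi^t* *m psi) 0 0 = \tr ((coefmx phi)^t* *m coefmx psi).
Proof.
rewrite mxtrace_mulC /mxtrace !mxE sum_mxtens; apply: eq_bigr => i _.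
by rewrite mxE; apply: eq_bigr => j _; rewrite !mxE mulrC.
Qed.

Lemma coefmxZ (c : C) psi : coefmx (c *: psi) = c *: coefmx psi.
Proof. by apply/matrixP => i j; rewrite !mxE. Qed.

Lemma reducedZ (c : R) psi : reduced (c%:C *: psi) = (c ^+ 2)%:C *: reduced psi.
Proof.
rewrite /reduced coefmxZ -scalemxAl; apply/matrixP => i j.
rewrite !mxE rmorphXn expr2 -mulrA; congr (_ * _).
rewrite mulr_sumr; apply: eq_bigr => k _; rewrite !mxE rmorphM /=.
by rewrite (conjc_real c : Num.conj c%:C = _) mulrCA.
Qed.

End CoefficientMatrix.

Section Spread.
Variables (n : nat) (Lambda : 'I_n -> R).
Implicit Types (sigma V : 'M[C]_n) (c : R).

(** When [sigma] is the reduced state of a unit vector and [V] is unitary, these are the outcome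
    probabilities of a measurement in the basis of columns of [V]. *)
Definition weight sigma V j : R := complex.Re ((V^t* *m sigma *m V) j j).

(* The second moment about [c], in the state [sigma], of the observable with
   eigenvalues [Lambda] and eigenvectors the columns of [V]. *)
Definition spread sigma V c : R := \sum_j (Lambda j - c) ^+ 2 * weight sigma V j.

Lemma weight_sum I (r : seq I) (F : I -> 'M[C]_n) V j :
  weight (\sum_(i <- r) F i) V j = \sum_(i <- r) weight (F i) V j.
Proof.
by rewrite /weight mulmx_sumr mulmx_suml summxE raddf_sum.
Qed.

Lemma spread_sum I (r : seq I) (F : I -> 'M[C]_n) V c :
  spread (\sum_(i <- r) F i) V c = \sum_(i <- r) spread (F i) V c.
Proof.
rewrite /spread exchange_big /=; apply: eq_bigr => j _.
by rewrite weight_sum mulr_sumr.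
Qed.

Lemma spreadZ a sigma V c : spread (a%:C *: sigma) V c = a * spread sigma V c.
Proof.
rewrite /spread mulr_sumr; apply: eq_bigr => j _.
by rewrite /weight -scalemxAr -scalemxAl mxE Re_scale mulrCA.
Qed.

Lemma spread_conj U sigma V c :
  spread (U *m sigma *m U^t*) V c = spread sigma (U^t* *m V) c.
Proof.
apply: eq_bigr => j _; rewrite /weight trmxC_mul trmxCK.
by rewrite !mulmxA.
Qed.

Lemma weight_ge0 m (X : 'M[C]_(n, m)) V j : 0 <= weight (X *m X^t*) V j.
Proof.
rewrite /weight; have -> : V^t* *m (X *m X^t*) *m V =
    (V^t* *m X) *m (V^t* *m X)^t* by rewrite trmxC_mul trmxCK !mulmxA.
rewrite mxE raddf_sum sumr_ge0 // => k _; rewrite !mxE.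
by case: (\sum_j0 _) => a b /=; rewrite mulrN opprK addr_ge0 // -expr2 sqr_ge0.
Qed.

Lemma spread_ge0 m (X : 'M[C]_(n, m)) V c : 0 <= spread (X *m X^t*) V c.
Proof. by rewrite sumr_ge0 // => j _; rewrite mulr_ge0 ?sqr_ge0 ?weight_ge0. Qed.

End Spread.

End PureStates.

(** * Skew information of a pure state as a variance *)

Lemma sqrtmx_idempotent (C : numClosedFieldType) n (A : 'M[C]_n) :
  A \is normalmx -> A *m A = A -> sqrtmx A = A.
Proof.
move=> /orthomx_spectralP AE AA; rewrite /sqrtmx [RHS]AE.
have Pu := spectral_unit A.
congr (_ *m diag_mx _ *m _).
(* Idempotence passes to the spectrum, so every eigenvalue is 0 or 1 and is its own square root. *)
have : diag_mx (spectral_diag A) *m diag_mx (spectral_diag A)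
    = diag_mx (spectral_diag A).
  move: AE; set P := spectralmx A in Pu *; set D := diag_mx _ => AE.
  have -> : D = P *m A *m invmx P by rewrite AE !mulmxA mulmxV // mul1mx mulmxK.
  by rewrite !mulmxA mulmxKV // -[_ *m A *m A]mulmxA AA.
rewrite mulmx_diag => /matrixP dd.
apply/rowP => j; have := dd j j; rewrite !mxE eqxx !mulr1n => /eqP.
rewrite -subr_eq0 -{3}[spectral_diag A 0 j]mulr1 -mulrBr mulf_eq0 subr_eq0.
by move=> /orP[]/eqP ->; rewrite (sqrtC0, sqrtC1).
Qed.

Lemma tensmx1 (F : pzRingType) m n :
  (1%:M : 'M[F]_m) *t (1%:M : 'M[F]_n) = 1%:M.
Proof.
apply/matrixP => x y; case: (mxtens_indexP x) => i j.
case: (mxtens_indexP y) => k l; rewrite tensmxE !mxE.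
by rewrite (can_eq (@mxtens_indexK m n)) xpair_eqE -natrM mulnb.
Qed.

Section PureSkew.
Local Open Scope complex_scope.
Variable R : realType.
Local Notation C := R[i].

Lemma sqrtmx_density n (psi : 'cV[C]_n) : psi^t* *m psi = 1%:M ->
  sqrtmx (density_of psi) = density_of psi.
Proof.
move=> psi1; apply: sqrtmx_idempotent; first exact: normalmx_mul_trC.
by rewrite /density_of mulmxA -[_ *m psi]mulmxA psi1 mulmx1.
Qed.

(** The density matrix is a projector, hence its own square root. Of the four traces in the squared
    commutator, two give the squared mean of [K] and two, with sign minus, the mean of [K *m K]; the
    prefactor -1/2 leaves the variance. *)
Lemma skew_information_pure n (psi : 'cV[C]_n) (K : 'M[C]_n) :
  psi^t* *m psi = 1%:M ->
  skew_information (density_of psi) K =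
    complex.Re ((psi^t* *m (K *m K) *m psi) 0 0 - (psi^t* *m K *m psi) 0 0 ^+ 2).
Proof.
move=> psi1; rewrite /skew_information sqrtmx_density //.
set rho := density_of psi; set k := (psi^t* *m K *m psi) 0 0.
set k2 := (psi^t* *m (K *m K) *m psi) 0 0.
have rr : rho *m rho = rho.
  by rewrite /rho /density_of mulmxA -[_ *m psi]mulmxA psi1 mulmx1.
have kE : psi^t* *m K *m psi = k%:M by exact: mx11_scalar.
have tr1 : \tr (rho *m K *m (rho *m K)) = k ^+ 2.
  have -> : rho *m K *m (rho *m K) =
      psi *m ((psi^t* *m K *m psi) *m (psi^t* *m K)).
    by rewrite /rho /density_of !mulmxA.
  rewrite kE mul_scalar_mx -scalemxAr mxtraceZ mxtrace_mulC kE.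
  by rewrite mxtrace_scalar expr2.
have tr2 : \tr (rho *m K *m (K *m rho)) = k2.
  rewrite mxtrace_mulC mulmxA -[K *m rho *m rho]mulmxA rr -mulmxA.
  rewrite mxtrace_mulC -mulmxA /rho /density_of -mulmxA mxtrace_mulC.
  by rewrite trace_mx11 /k2 !mulmxA.
clearbody rho k k2.
have -> : \tr ((rho *m K - K *m rho) *m (rho *m K - K *m rho)) =
    - 2 * (k2 - k ^+ 2).
  have trB (X Y : 'M[C]_n) : \tr (X - Y) = \tr X - \tr Y by exact: raddfB.
  rewrite mulmxBl mulmxBr mulmxBr trB trB trB tr1 tr2.
  have -> : \tr (K *m rho *m (rho *m K)) = k2 by rewrite mxtrace_mulC.
  have -> : \tr (K *m rho *m (K *m rho)) = k ^+ 2.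
    by rewrite -tr1 -mulmxA mxtrace_mulC !mulmxA.
  ring.
have -> : (- 2 : C) = (- 2 : R)%:C by rewrite rmorphN rmorph_nat.
rewrite Re_scale; by field.
Qed.

Variables (dA dB : nat) (Lambda : 'I_dA -> R).
Implicit Types (psi : 'cV[C]_(dA * dB)) (V : 'M[C]_dA).

Lemma expectation_local psi V (f : 'I_dA -> R) :
  (psi^t* *m ((V *m diag_mx (\row_j (f j)%:C) *m V^t*) *t 1%:M) *m psi) 0 0 =
  (\sum_j f j * weight (reduced psi) V j)%:C.
Proof.
set K := V *m _ *m _.
rewrite -mulmxA inner_coefmx coefmx_tens trmx1 mulmx1 mxtrace_mulC.
set H := V^t* *m reduced psi *m V.
have Hreal : H^t* = H.
  by rewrite /H /reduced !trmxC_mul !trmxCK !mulmxA.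
have -> : \tr (K *m coefmx psi *m (coefmx psi)^t*) =
    \tr (diag_mx (\row_j (f j)%:C) *m H).
  by rewrite -mulmxA /K -!mulmxA mxtrace_mulC -!mulmxA /H /reduced -!mulmxA.
rewrite /mxtrace rmorph_sum; apply: eq_bigr => j _.
rewrite mul_diag_mx mxE mxE rmorphM /=; congr (_ * _).
rewrite /weight -/H.
(* A diagonal entry of the Hermitian [H] equals its conjugate, so taking the real part in [weight]
   loses nothing. *)
move/matrixP/(_ j j): Hreal; rewrite mxE mxE.
case: (H j j) => a b /= -[] bE.
have -> : b = 0 by lra.
by [].
Qed.

Lemma skew_information_local psi V : psi^t* *m psi = 1%:M -> V \is unitarymx ->
  skew_information (density_of psi)
    ((V *m diag_mx (\row_j (Lambda j)%:C) *m V^t*) *t 1%:M) =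
  \sum_j Lambda j ^+ 2 * weight (reduced psi) V j
  - (\sum_j Lambda j * weight (reduced psi) V j) ^+ 2.
Proof.
move=> psi1 Vu; rewrite skew_information_pure // tensmx_mul mulmx1.
set K := V *m _ *m _.
have -> : K *m K = V *m diag_mx (\row_j (Lambda j ^+ 2)%:C) *m V^t*.
  rewrite /K !mulmxA; congr (_ *m _); rewrite -!mulmxA; congr (_ *m _).
  rewrite [V^t* *m _]mulmxA unitarymx_trC_mul // mul1mx mulmx_diag.
  by congr diag_mx; apply/rowP => j; rewrite !mxE rmorphXn.
rewrite [X in complex.Re (X - _)]
  (expectation_local psi V (fun j => Lambda j ^+ 2)).
rewrite (expectation_local psi V Lambda).
set a := \sum_j _; set b := \sum_j _.
by rewrite -[b%:C ^+ 2](rmorphXn (real_complex R)) -rmorphB.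
Qed.

Lemma weight_total psi V : psi^t* *m psi = 1%:M -> V \is unitarymx ->
  \sum_j weight (reduced psi) V j = 1.
Proof.
move=> psi1 Vu.
(* For the constant function 1 the observable is the identity, whose expectation is the squared norm
   of [psi]. *)
have := expectation_local psi V (fun=> 1).
have -> : (\row_(j < dA) (1 : R)%:C) = const_mx 1 by apply/rowP => j; rewrite !mxE.
rewrite diag_const_mx mulmx1 (unitarymxP Vu) tensmx1.
rewrite mulmx1 psi1 mxE eqxx => /(congr1 (@complex.Re R)) /= ->.
by apply: eq_bigr => j _; rewrite mul1r.
Qed.

(** The second moment about [c] is the variance plus the squared distance from [c] to the mean.
    Hence [spread] bounds the skew information for every [c], with equality at the mean. *)
Lemma skew_information_spread psi V c : psi^t* *m psi = 1%:M ->
  V \is unitarymx ->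
  skew_information (density_of psi)
    ((V *m diag_mx (\row_j (Lambda j)%:C) *m V^t*) *t 1%:M) =
  spread Lambda (reduced psi) V c
  - (c - \sum_j Lambda j * weight (reduced psi) V j) ^+ 2.
Proof.
move=> psi1 Vu; rewrite skew_information_local //.
set w := weight _ _; set m := \sum_j Lambda j * w j.
suff -> : spread Lambda (reduced psi) V c =
    \sum_j Lambda j ^+ 2 * w j - 2 * c * m + c ^+ 2 by ring.
have -> : c ^+ 2 = \sum_j c ^+ 2 * w j.
  by rewrite -mulr_sumr /w weight_total // mulr1.
rewrite /m mulr_sumr -sumrB -big_split.
by apply: eq_bigr => j _ /=; rewrite -/w; ring.
Qed.

Lemma lqu_le_spread psi V c : psi^t* *m psi = 1%:M -> V \is unitarymx ->
  lqu Lambda (density_of psi) <= spread Lambda (reduced psi) V c.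
Proof.
move=> psi1 Vu; have [_ _ [_ lb]] := lqu_min Lambda (density_of psi).
apply: le_trans (lb _ _) _; first by exists V.
by rewrite (skew_information_spread c) // gerBl sqr_ge0.
Qed.

Lemma lqu_eq_spread psi : psi^t* *m psi = 1%:M ->
  exists V c, V \is unitarymx /\
    lqu Lambda (density_of psi) = spread Lambda (reduced psi) V c.
Proof.
move=> psi1; have [_ [V Vu ->] [-> _]] := lqu_min Lambda (density_of psi).
exists V, (\sum_j Lambda j * weight (reduced psi) V j); split=> //.
set c := \sum_j _.
by rewrite (skew_information_spread c) // subrr expr0n subr0.
Qed.

End PureSkew.

(** * Monotonicity under one round and under a whole protocol *)

Section Monotonicity.
Local Open Scope complex_scope.
Variable R : realType.
Local Notation C := R[i].

Lemma inner_selfE n (phi : 'cV[C]_n) :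
  (phi^t* *m phi) 0 0 =
  (\sum_k (complex.Re (phi k 0) ^+ 2 + complex.Im (phi k 0) ^+ 2))%:C.
Proof.
rewrite mxE rmorph_sum; apply: eq_bigr => k _; rewrite !mxE.
case: (phi k 0) => a b /=.
by apply/eqP; rewrite eq_complex /=; apply/andP; split; apply/eqP; ring.
Qed.

Lemma outcome_prob_ge0 n (M : 'M[C]_n) psi : 0 <= outcome_prob M psi.
Proof.
by rewrite /outcome_prob inner_selfE sumr_ge0 // => k _; rewrite addr_ge0 ?sqr_ge0.
Qed.

Lemma outcome_state_unit n (M : 'M[C]_n) psi : outcome_prob M psi != 0 ->
  (outcome_state M psi)^t* *m outcome_state M psi = 1%:M.
Proof.
move=> p0; set p := outcome_prob M psi in p0 *.
have p_ge0 : 0 <= p := outcome_prob_ge0 _ _.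
have E : (M *m psi)^t* *m (M *m psi) = p%:C%:M.
  by rewrite [LHS]mx11_scalar /p /outcome_prob inner_selfE.
rewrite /outcome_state -/p; set s := (Num.sqrt p)^-1.
have -> : (s%:C *: (M *m psi))^t* = s%:C *: (M *m psi)^t*.
  apply/matrixP => i j; rewrite !mxE rmorphM /=.
  by rewrite (conjc_real s : Num.conj s%:C = _).
rewrite -scalemxAr -scalemxAl E !scale_scalar_mx -!rmorphM.
suff -> : s * (s * p) = 1 by [].
by rewrite mulrA -expr2 exprVn sqr_sqrtr // mulVf.
Qed.

Section Protocol.
Variables (dA dB : nat) (Lambda : 'I_dA -> R).
Local Notation n := (dA * dB)%N.
Implicit Types psi : 'cV[C]_n.

(** By homogeneity of [spread], the probability cancels the normalisation of the outcome state,
    leaving the unnormalised vector on the right. *)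
Lemma outcome_lqu_le (M : 'M[C]_n) psi V c :
  outcome_prob M psi != 0 -> V \is unitarymx ->
  outcome_prob M psi * lqu Lambda (density_of (outcome_state M psi))
    <= spread Lambda (reduced (M *m psi)) V c.
Proof.
move=> p0 Vu; have p_ge0 := outcome_prob_ge0 M psi.
have := lqu_le_spread Lambda c (outcome_state_unit p0) Vu.
move/(ler_wpM2l p_ge0)/le_trans; apply.
rewrite /outcome_state reducedZ spreadZ exprVn sqr_sqrtr //.
by rewrite mulrA divff // mul1r.
Qed.

(** The last hypothesis is all that distinguishes the rounds of A from those of B: each outcome gets
    its own eigenbasis [W i], but the centre [c] is shared. Starting from an optimal [V] and [c] for
    [psi], each [W i] and the same [c] are trial values for outcome [i]. *)
Lemma round_ensemble_le k (G : 'I_k -> 'M[C]_n)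
    (next : 'I_k -> 'cV[C]_n -> seq (R * 'cV[C]_n)) psi :
  psi^t* *m psi = 1%:M ->
  (forall i phi, phi^t* *m phi = 1%:M ->
    \sum_(o <- next i phi) o.1 * lqu Lambda (density_of o.2)
      <= lqu Lambda (density_of phi)) ->
  (forall V, V \is unitarymx -> exists2 W : 'I_k -> 'M[C]_dA,
    forall i, W i \is unitarymx &
    forall c, \sum_i spread Lambda (reduced (G i *m psi)) (W i) c =
      spread Lambda (reduced psi) V c) ->
  \sum_(o <- round_ensemble G next psi) o.1 * lqu Lambda (density_of o.2)
    <= lqu Lambda (density_of psi).
Proof.
move=> psi1 next_le rotate.
have [V [c [Vu ->]]] := lqu_eq_spread Lambda psi1.
have [W Wu <-] := rotate V Vu.
rewrite /round_ensemble big_flatten big_map big_filter big_enum_cond /=.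
rewrite [leRHS](bigID (fun i => outcome_prob (G i) psi != 0)) /=.
rewrite -[leLHS]addr0 lerD //; last first.
  by rewrite sumr_ge0 // => i _; exact: spread_ge0.
apply: ler_sum => i p0; rewrite big_map /=.
under eq_bigr do rewrite -mulrA; rewrite -mulr_sumr.
apply: le_trans (outcome_lqu_le c p0 (Wu i)).
by rewrite ler_wpM2l ?outcome_prob_ge0 // next_le // outcome_state_unit.
Qed.

Lemma roundA_rotate k (M : 'I_k -> 'M[C]_dA) psi V : kraus M ->
  V \is unitarymx -> exists2 W : 'I_k -> 'M[C]_dA,
    forall i, W i \is unitarymx &
    forall c, \sum_i spread Lambda (reduced ((M i *t 1%:M) *m psi)) (W i) c =
      spread Lambda (reduced psi) V c.
Proof.
move=> krausM Vu; have [S SE] := square_factor (coefmx psi).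
have [U0 U0u U0E] := mul_trC_unitary_similar S.
have /fin_all_exists2[U Uu UE] := fun i => mul_trC_unitary_similar (M i *m S).
(* Undoing [U0] expresses the spread of [psi] through [S^t* *m S] in the basis [U0^t* *m V].
   Applying [U i] carries that basis to the one in which outcome [i] has the spread of its summand
   of [S^t* *m S]. *)
exists (fun i => U i *m U0^t* *m V).
  move=> i; apply: mul_unitarymx Vu.
  by apply: mul_unitarymx; [exact: Uu | rewrite trmxC_unitary].
move=> c; rewrite [in RHS]/reduced SE U0E spread_conj.
have -> : S^t* *m S = \sum_i (M i *m S)^t* *m (M i *m S).
  rewrite -{2}[S]mul1mx -krausM mulmx_suml mulmx_sumr.
  by apply: eq_bigr => i _; rewrite trmxC_mul !mulmxA.
rewrite spread_sum; apply: eq_bigr => i _.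
rewrite /reduced coefmx_tens trmx1 mulmx1.
have -> : M i *m coefmx psi *m (M i *m coefmx psi)^t* =
    (M i *m S) *m (M i *m S)^t*.
  by rewrite !trmxC_mul !mulmxA -[M i *m _ *m _^t*]mulmxA SE !mulmxA.
rewrite UE spread_conj -(mulmxA (U i)) (mulmxA ((U i)^t*)).
by rewrite (unitarymx_trC_mul (Uu i)) mul1mx.
Qed.

Lemma roundB_rotate k (N : 'I_k -> 'M[C]_dB) psi V : kraus N ->
  V \is unitarymx -> exists2 W : 'I_k -> 'M[C]_dA,
    forall i, W i \is unitarymx &
    forall c, \sum_i spread Lambda (reduced ((1%:M *t N i) *m psi)) (W i) c =
      spread Lambda (reduced psi) V c.
Proof.
move=> krausN Vu; exists (fun=> V) => // c; rewrite -spread_sum; congr spread.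
set X := coefmx psi.
(* Operators of B act on [X] from the right by their transposes, so the Kraus relation is inserted
   transposed between [X] and its adjoint. *)
have -> : reduced psi = X *m (\sum_i (N i)^t* *m N i)^T *m X^t*.
  by rewrite krausN trmx1 mulmx1.
rewrite linear_sum /= mulmx_sumr mulmx_suml; apply: eq_bigr => i _.
rewrite /reduced coefmx_tens mul1mx -/X trmxC_mul trmx_mul !mulmxA.
by rewrite map_trmx !trmxK.
Qed.

Lemma lqu_ensemble_le (P : locc R dA dB) psi : psi^t* *m psi = 1%:M ->
  \sum_(o <- ensemble P psi) o.1 * lqu Lambda (density_of o.2)
    <= lqu Lambda (density_of psi).
Proof.
elim: P psi => [|k M krausM next IH|k N krausN next IH] psi psi1 /=.
- by rewrite big_seq1 mul1r.
- apply: round_ensemble_le => // V Vu; exact: roundA_rotate.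
- apply: round_ensemble_le => // V Vu; exact: roundB_rotate.
Qed.

End Protocol.
End Monotonicity.

Theorem mainTheorem6 (R : realType) (dA dB : nat)
    (Lambda : 'I_dA -> R) (hLambda : injective Lambda)
    (psi : 'cV[R[i]]_(dA * dB)) (hpsi : psi^t* *m psi = 1%:M)
    (P : locc R dA dB) :
  \sum_(o <- ensemble P psi) o.1 * lqu Lambda (density_of o.2)
    <= lqu Lambda (density_of psi).
Proof. exact: lqu_ensemble_le. Qed.
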